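(* Let $(V,|0\rangle,T,Y,\mathcal{S})$ be a braided state-field correspondence in which the associativity relation holds: for any $a,b,c\in V$ and $M\in\mathbb{Z}_{\ge0}$ there exists $N\in\mathbb{Z}_{\ge0}$ such that $$\iota_{z,w}(z+w)^NY(z+w)(1\otimes Y(w))(a\otimes b\otimes c)=(z+w)^NY(w)(Y(z)\otimes1)(a\otimes b\otimes c)\pmod{h^M}.$$ Then, for all $a,b,c\in V$ and $M\in\mathbb{Z}_{\ge0}$, and with such $N$, $$\partial_\lambda^N\,a_\lambda(b_\mu c)=\partial_\lambda^N\,(a_\lambda b)_{\lambda+\mu}c\pmod{h^M}.$$
   Context: $\mathbb{K}$ is a field of characteristic zero. A topologically free $\mathbb{K}[[h]]$-module is one isomorphic to $W[[h]]$ for a $\mathbb{K}$-vector space $W$; $U[[h]]\hat\otimes W[[h]]:=(U\otimes W)[[h]]$. $V_h((z))$ is the set of $a(z)\in V[[z,z^{-1}]]$ such that $a(z)\in V((z))$ modulo $h^M$ for every $M\ge0$. $\mathrm{Res}_z$ is the coefficient of $z^{-1}$. $\iota_{z,w}$ denotes expansion in the domain $|z|>|w|$ (nonnegative powers of $w$). A braided state-field correspondence $(V,|0\rangle,T,Y,\mathcal{S})$ consists of: a topologically free $\mathbb{K}[[h]]$-module $V$ with a nonzero vector $|0\rangle$ and a $\mathbb{K}[[h]]$-linear $T:V\to V$ with $T|0\rangle=0$; a $\mathbb{K}[[h]]$-linear map $Y:V\hat\otimes V\to V_h((z))$, written $Y(z)(a\otimes b)=Y(a,z)b=\sum_{n\in\mathbb{Z}}a_{(n)}b\,z^{-n-1}$,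 with $Y(z)(|0\rangle\otimes v)=v$, $Y(z)(v\otimes|0\rangle)\in v+V[[z]]z$ for all $v\in V$, and $\partial_zY(z)=TY(z)-Y(z)(1\otimes T)=Y(z)(T\otimes1)$; and a braiding, i.e. a $\mathbb{K}[[h]]$-linear map $\mathcal{S}(z):V\hat\otimes V\to V\hat\otimes V\hat\otimes(\mathbb{K}((z))[[h]])$ with $\mathcal{S}=1+O(h)$. The $\lambda$-product is $a_\lambda b=\mathrm{Res}_z\,e^{\lambda z}Y(z)(a\otimes b)=\sum_{n\ge0}\frac{\lambda^n}{n!}a_{(n)}b$, which is polynomial in $\lambda$ with coefficients in $V$ modulo each $h^M$; it is extended linearly over the formal variables, so that $(a_\lambda b)_{\lambda+\mu}c=\sum_{m,n\ge0}\frac{\lambda^m}{m!}\frac{(\lambda+\mu)^n}{n!}(a_{(m)}b)_{(n)}c$. *)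

(* Defs.v *)
From HB Require Import structures.
From mathcomp Require Import all_boot all_order all_algebra.
From mathcomp Require Import boolp classical_sets functions.
From mathcomp Require Import freeg.

Set Implicit Arguments.
Unset Strict Implicit.
Unset Printing Implicit Defensive.

Import Order.TTheory GRing.Theory Num.Theory.
Local Open Scope ring_scope.

Definition cauchy (A B : Type) (C : nmodType) (op : A -> B -> C)
    (f : nat -> A) (g : nat -> B) : nat -> C :=
  fun n => \sum_(i < n.+1) op (f i) (g (n - i)%N).

Lemma cauchy_sumA (M : nmodType) (F : nat -> nat -> nat -> M) n :
  \sum_(i < n.+1) \sum_(j < i.+1) F j (i - j)%N (n - i)%N =
  \sum_(j < n.+1) \sum_(k < (n - j).+1) F j k (n - j - k)%N.
Proof.
under eq_bigr => i _.
  rewrite (big_ord_widen n.+1 (fun j => F j (i - j)%N (n - i)%N) (ltn_ord i)).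
  over.
rewrite (exchange_big_dep predT) //=; apply: eq_bigr => j _.
rewrite -(big_mkord (fun i => (j < i.+1)%N) (fun i => F j (i - j)%N (n - i)%N)).
rewrite -(big_mkord predT (fun k => F j k (n - j - k)%N)).
have jn : (j <= n.+1)%N by rewrite ltnW.
rewrite (big_cat_nat (leq0n j) jn) /=.
rewrite big_nat_cond big_pred0 ?add0r; last first.
  by move=> i; rewrite ltnS; case: ltngtP; rewrite ?andbF.
rewrite -{1}(add0n (val j)) big_addn subSn; last by rewrite -ltnS ltn_ord.
under eq_bigl do rewrite ltnS leq_addl.
by apply: eq_bigr => i _; rewrite addnK -subnDA addnC.
Qed.

Lemma cauchyC (A : Type) (C : nmodType) (op : A -> A -> C) f g :
  commutative op -> cauchy op f g = cauchy op g f.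
Proof.
move=> opC; apply/funext => n; rewrite /cauchy (reindex_inj rev_ord_inj) /=.
apply: eq_bigr => i _; rewrite subSS opC; congr (op (g _) _).
by rewrite subKn // -ltnS.
Qed.

(* K[[h]]; the alias keeps the Cauchy product apart from the pointwise
   product of functions, and likewise for the scaling of W[[h]] below. *)
Definition fps (K : fieldType) : Type := nat -> K.

Section Fps.
Variable K : fieldType.
Implicit Types f g : fps K.

HB.instance Definition _ := GRing.Zmodule.copy (fps K) (nat -> K).

Lemma fps_addE f g n : (f + g) n = f n + g n. Proof. by []. Qed.

Definition fpsC (c : K) : fps K := fun n => if n == 0%N then c else 0.

Definition fps_mul f g : fps K := cauchy *%R f g.

Lemma fps_mulA : associative fps_mul.
Proof.
move=> f g k; apply/funext => n; rewrite /fps_mul /cauchy.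
under eq_bigr do rewrite mulr_sumr.
under [in RHS]eq_bigr do rewrite mulr_suml.
rewrite (cauchy_sumA (fun a b c => f a * g b * k c)).
by apply: eq_bigr => i _; apply: eq_bigr => j _; rewrite mulrA.
Qed.

Lemma fps_mulC : commutative fps_mul.
Proof. by move=> f g; apply: cauchyC; exact: mulrC. Qed.

Lemma fps_mul1 : left_id (fpsC 1) fps_mul.
Proof.
move=> f; apply/funext => n; rewrite /fps_mul /cauchy big_ord_recl /= mul1r.
by rewrite subn0 big1 ?addr0 // => i _; rewrite /fpsC /= mul0r.
Qed.

Lemma fps_mulDl : left_distributive fps_mul +%R.
Proof.
move=> f g k; apply/funext => n; rewrite [RHS]fps_addE /fps_mul /cauchy -big_split; apply: eq_bigr => i _.
exact: mulrDl.
Qed.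

Lemma fps_oner_neq0 : fpsC 1 != 0 :> fps K.
Proof. by apply/eqP => /(congr1 (fun f => f 0%N)) /eqP; rewrite oner_eq0. Qed.

HB.instance Definition _ := GRing.Zmodule_isComNzRing.Build (fps K)
  fps_mulA fps_mulC fps_mul1 fps_mulDl fps_oner_neq0.

Definition hpar : fps K := fun n => (n == 1%N)%:R.

End Fps.

Definition hser (K : fieldType) (W : lmodType K) : Type := nat -> W.

Section Hser.
Variables (K : fieldType) (W : lmodType K).
Implicit Types (f g : fps K) (a b : hser W).

HB.instance Definition _ := GRing.Zmodule.copy (hser W) (nat -> W).

Lemma hser_addE a b n : (a + b) n = a n + b n. Proof. by []. Qed.

Definition hser_scale f a : hser W := cauchy *:%R f a.

Lemma hser_scaleA f g a : hser_scale f (hser_scale g a) = hser_scale (f * g) a.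
Proof.
apply/funext => n; rewrite /hser_scale /cauchy.
under eq_bigr do rewrite scaler_sumr.
rewrite [RHS](_ : _ = \sum_(i < n.+1) \sum_(j < i.+1)
    (f j * g (i - j)%N) *: a (n - i)%N); last first.
  by apply: eq_bigr => i _; rewrite -scaler_suml.
rewrite (cauchy_sumA (fun p q r => (f p * g q) *: a r)).
by apply: eq_bigr => i _; apply: eq_bigr => j _; rewrite scalerA.
Qed.

Lemma hser_scale1 : left_id 1 hser_scale.
Proof.
move=> a; apply/funext => n; rewrite /hser_scale /cauchy big_ord_recl /=.
rewrite scale1r subn0 big1 ?addr0 // => i _.
by rewrite [X in X *: _]/= scale0r.
Qed.

Lemma hser_scaleDr : right_distributive hser_scale +%R.
Proof.
move=> f a b; apply/funext => n; rewrite [RHS]hser_addE /hser_scale /cauchy -big_split; apply: eq_bigr => i _.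
exact: scalerDr.
Qed.

Lemma hser_scaleDl a : {morph hser_scale^~ a : f g / f + g}.
Proof.
move=> f g; apply/funext => n; rewrite [RHS]hser_addE /hser_scale /cauchy -big_split; apply: eq_bigr => i _.
exact: scalerDl.
Qed.

HB.instance Definition _ := GRing.Zmodule_isLmodule.Build (fps K) (hser W)
  hser_scaleA hser_scale1 hser_scaleDr hser_scaleDl.

Definition hserC (w : W) : hser W := fun n => if n == 0%N then w else 0.

End Hser.

Section Tensor.
Variables (K : fieldType) (U W : lmodType K).

Local Notation free := {freeg (U * W) / K}.

Definition fgen (u : U) (w : W) : free := << (u, w) >>.

Inductive tens_rel : free -> Prop :=
| TR_addl u u' w : tens_rel (fgen (u + u') w - (fgen u w + fgen u' w))
| TR_addr u w w' : tens_rel (fgen u (w + w') - (fgen u w + fgen u w'))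
| TR_scalel c u w : tens_rel (fgen (c *: u) w - c *: fgen u w)
| TR_scaler c u w : tens_rel (fgen u (c *: w) - c *: fgen u w)
| TR_zero : tens_rel 0
| TR_lin c x y : tens_rel x -> tens_rel y -> tens_rel (c *: x + y).

Definition tens_relb : {pred free} := fun x => `[< tens_rel x >].

Lemma tens_relP x : reflect (tens_rel x) (x \in tens_relb).
Proof. exact: asboolP. Qed.

Lemma tens_rel_closed : submod_closed tens_relb.
Proof.
split; first exact/tens_relP/TR_zero.
by move=> c x y /tens_relP xr /tens_relP yr; exact/tens_relP/TR_lin.
Qed.

HB.instance Definition _ :=
  GRing.isSubmodClosed.Build K free tens_relb tens_rel_closed.

Definition tensor : Type := Quotient.quot tens_relb.

HB.instance Definition _ := GRing.Zmodule.on tensor.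
HB.instance Definition _ :=
  ZmodQuotient.copy tensor (Quotient.quot tens_relb).

Local Open Scope quotient_scope.

Definition tens (u : U) (w : W) : tensor := \pi_tensor (fgen u w).

Definition tensor_scale (c : K) (t : tensor) : tensor :=
  \pi_tensor (c *: repr t).

Lemma tensor_piE (x y : free) :
  (\pi_tensor x = \pi_tensor y) <-> tens_rel (x - y).
Proof.
split.
  by move=> /eqP; rewrite -Quotient.idealrBE => /tens_relP.
by move=> h; apply/eqP; rewrite -Quotient.idealrBE; exact/tens_relP.
Qed.

Lemma pi_tensor_scale c x : \pi_tensor (c *: x) = tensor_scale c (\pi_tensor x).
Proof.
apply/tensor_piE; rewrite -scalerBr -[_ *: _]addr0.
apply: TR_lin; last exact: TR_zero.
by apply/tensor_piE; rewrite reprK.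
Qed.

Lemma tensor_scaleA a b t :
  tensor_scale a (tensor_scale b t) = tensor_scale (a * b) t.
Proof.
rewrite -[t]reprK -(pi_tensor_scale b) -(pi_tensor_scale a) scalerA.
exact: pi_tensor_scale.
Qed.

Lemma tensor_scale1 : left_id 1 tensor_scale.
Proof. by move=> t; rewrite -[t]reprK -pi_tensor_scale scale1r. Qed.

Lemma tensor_scaleDr : right_distributive tensor_scale +%R.
Proof.
move=> c s t; rewrite -[s]reprK -[t]reprK -raddfD -!pi_tensor_scale.
by rewrite scalerDr raddfD.
Qed.

Lemma tensor_scaleDl t : {morph tensor_scale^~ t : a b / a + b}.
Proof.
move=> a b /=; rewrite -[t]reprK -!pi_tensor_scale.
by rewrite scalerDl raddfD.
Qed.

HB.instance Definition _ := GRing.Zmodule_isLmodule.Build K tensor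
  tensor_scaleA tensor_scale1 tensor_scaleDr tensor_scaleDl.

Lemma tensDl u u' w : tens (u + u') w = tens u w + tens u' w.
Proof. by rewrite -raddfD; apply/tensor_piE/TR_addl. Qed.

Lemma tensDr u w w' : tens u (w + w') = tens u w + tens u w'.
Proof. by rewrite -raddfD; apply/tensor_piE/TR_addr. Qed.

Lemma tensZl c u w : tens (c *: u) w = c *: tens u w.
Proof. by rewrite -[RHS]pi_tensor_scale; apply/tensor_piE/TR_scalel. Qed.

Lemma tensZr c u w : tens u (c *: w) = c *: tens u w.
Proof. by rewrite -[RHS]pi_tensor_scale; apply/tensor_piE/TR_scaler. Qed.

Lemma tens_suml (I : Type) (r : seq I) (F : I -> U) w :
  tens (\sum_(i <- r) F i) w = \sum_(i <- r) tens (F i) w.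
Proof.
elim: r => [|i r IH]; last by rewrite !big_cons tensDl IH.
by rewrite !big_nil -(scale0r 0) tensZl scale0r.
Qed.

Lemma tens_sumr (I : Type) (r : seq I) u (F : I -> W) :
  tens u (\sum_(i <- r) F i) = \sum_(i <- r) tens u (F i).
Proof.
elim: r => [|i r IH]; last by rewrite !big_cons tensDr IH.
by rewrite !big_nil -(scale0r 0) tensZr scale0r.
Qed.

Definition bilinear2 (X : lmodType K) (phi : U -> W -> X) : Prop :=
  (forall w, linear (phi^~ w)) /\ (forall u, linear (phi u)).

Definition tens_lift (X : lmodType K) (phi : U -> W -> X) (t : tensor) : X :=
  fglift (fun p => phi p.1 p.2) (repr t).

Section TensLift.
Variables (X : lmodType K) (phi : U -> W -> X).
Hypothesis phiL : bilinear2 phi.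

Local Notation flift := (fglift (fun p : U * W => phi p.1 p.2)).

Lemma flift_is_linear : linear flift.
Proof.
pose F := GRing.isZmodMorphism.Build free X flift (lift_is_additive _).
pose G : {additive free -> X} := HB.pack flift F.
have GE : flift = G by [].
have GZ c x : G (c *: x) = c *: G x.
  have -> : c *: x = \sum_(p <- dom x) << c * coeff p x *g p >> by [].
  rewrite -[X in _ = _ *: G X](freeg_sumE x) !raddf_sum /=.
  by apply: eq_bigr => p _; rewrite !liftU scalerA.
by move=> c x y; rewrite GE raddfD GZ.
Qed.

Lemma flift_rel x : tens_rel x -> flift x = 0.
Proof.
have [phil phir] := phiL.
pose F := GRing.isLinear.Build K free X *:%R flift flift_is_linear.
pose G : {linear free -> X} := HB.pack flift F.
have fB y z : flift (y - z) = flift y - flift z by exact: (raddfB G).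
have fD y z : flift (y + z) = flift y + flift z by exact: (raddfD G).
have fZ c y : flift (c *: y) = c *: flift y by exact: (linearZ_LR G).
have fU u w : flift (fgen u w) = phi u w by rewrite liftU scale1r.
have lin0 (A : lmodType K) (f : A -> X) : linear f -> f 0 = 0.
  move=> fL; apply: (addrI (f 0)); rewrite addr0.
  by rewrite -[in RHS](add0r 0) -[X in f (X + _)](scale1r 0) fL scale1r.
have linZ (A : lmodType K) (f : A -> X) c v : linear f -> f (c *: v) = c *: f v.
  by move=> fL; rewrite -[c *: v]addr0 fL lin0 // addr0.
have linD (A : lmodType K) (f : A -> X) v w : linear f -> f (v + w) = f v + f w.
  by move=> fL; rewrite -[v]scale1r fL !scale1r.
elim=> [u u' w|u w w'|c u w|c u w||c {}x y _ xr _ yr].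
- by rewrite fB fD !fU (linD _ _ _ _ (phil w)) subrr.
- by rewrite fB fD !fU (linD _ _ _ _ (phir u)) subrr.
- by rewrite fB fZ !fU (linZ _ _ _ _ (phil w)) subrr.
- by rewrite fB fZ !fU (linZ _ _ _ _ (phir u)) subrr.
- exact: (raddf0 G).
- by rewrite fD fZ xr yr scaler0 addr0.
Qed.

Lemma tens_lift_pi x : tens_lift phi (\pi_tensor x) = flift x.
Proof.
pose F := GRing.isLinear.Build K free X *:%R flift flift_is_linear.
pose G : {linear free -> X} := HB.pack flift F.
rewrite /tens_lift; apply/eqP; rewrite -subr_eq0; apply/eqP.
rewrite -[LHS](raddfB G); apply/flift_rel/tensor_piE.
by rewrite reprK.
Qed.

Lemma tens_lift_tens u w : tens_lift phi (tens u w) = phi u w.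
Proof. by rewrite tens_lift_pi liftU scale1r. Qed.

Lemma tens_lift_is_linear : linear (tens_lift phi).
Proof.
move=> c s t; rewrite -[s]reprK -[t]reprK.
rewrite -[c *: _]pi_tensor_scale -raddfD !tens_lift_pi.
exact: flift_is_linear.
Qed.

End TensLift.

End Tensor.

Record topFree (K : fieldType) := TopFree {
  tf_car :> lmodType (fps K);
  tf_base : lmodType K;
  tf_iso : {linear tf_car -> hser tf_base};
  tf_inv : hser tf_base -> tf_car;
  tf_isoK : cancel tf_iso tf_inv;
  tf_invK : cancel tf_inv tf_iso }.

Arguments tf_iso {K} t.
Arguments tf_inv {K} t.

Section TopFree.
Variable K : fieldType.
Implicit Types (V W : topFree K).

Definition hserTF (B : lmodType K) : topFree K :=
  @TopFree K (hser B) B idfun id (fun=> erefl) (fun=> erefl).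

Definition ctensor V1 V2 : topFree K :=
  hserTF (tensor (tf_base V1) (tf_base V2)).

Definition ctens V1 V2 (a : V1) (b : V2) : ctensor V1 V2 :=
  cauchy (@tens K _ _) (tf_iso V1 a) (tf_iso V2 b).

Definition eqmodh V (M : nat) (x y : V) : Prop :=
  exists v : V, x - y = hpar K ^+ M *: v.

(* The coefficients in h of f (v0 h^0), for v0 in the base space. *)
Definition tf_coef V W (f : V -> W) (v0 : tf_base V) : hser (tf_base W) :=
  tf_iso W (f (tf_inv V (hserC v0))).

(* The completed tensor product of two K[[h]]-linear maps: on the coefficient
   x_i in B1 (x) B2 of h^i it is induced by u (x) w |-> f u (x) g w. *)
Definition ctmap V1 V2 W1 W2 (f : V1 -> W1) (g : V2 -> W2)
    (x : ctensor V1 V2) : ctensor W1 W2 :=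
  fun n => \sum_(i < n.+1)
    tens_lift (X := nat -> tensor (tf_base W1) (tf_base W2))
      (fun u w => cauchy (@tens K _ _) (tf_coef f u) (tf_coef g w))
      (x i) (n - i)%N.

Lemma fctZDE (X : lmodType K) (f g : nat -> X) (c : K) n :
  (c *: f + g) n = c *: f n + g n.
Proof. by []. Qed.

Lemma tens_lift_bilin (B1 B2 W1 W2 : lmodType K) (X := nat -> tensor W1 W2)
    (p : B1 -> nat -> W1) (q : B2 -> nat -> W2) :
  (forall c u v n, p (c *: u + v) n = c *: p u n + p v n) ->
  (forall c u v n, q (c *: u + v) n = c *: q u n + q v n) ->
  bilinear2 (X := X) (fun u w => cauchy (@tens K _ _) (p u) (q w)).
Proof.
move=> pL qL; split=> [w|u] c v v'; apply/funext => n.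
  rewrite [RHS]fctZDE /cauchy scaler_sumr -big_split.
  by apply: eq_bigr => i _; rewrite pL tensDl tensZl.
rewrite [RHS]fctZDE /cauchy scaler_sumr -big_split.
by apply: eq_bigr => i _; rewrite qL tensDr tensZr.
Qed.

Lemma hpar_mulE (B : lmodType K) (a : hser B) n :
  (hpar K *: a) n = if n is m.+1 then a m else 0.
Proof.
rewrite [LHS](_ : _ = \sum_(i < n.+1) hpar K i *: a (n - i)%N) //.
case: n => [|n]; first by rewrite big_ord1 scale0r.
rewrite big_ord_recl scale0r add0r big_ord_recl scale1r subSS subn0.
by rewrite big1 ?addr0 // => i _; rewrite scale0r.
Qed.

Lemma hparX_mulE (B : lmodType K) (a : hser B) M n :
  (hpar K ^+ M *: a) n = if (n < M)%N then 0 else a (n - M)%N.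
Proof.
elim: M n => [|M IH] n; first by rewrite expr0 scale1r subn0.
by rewrite exprS -scalerA hpar_mulE; case: n => [|n] //; rewrite IH.
Qed.

Lemma fpsC_mulE (B : lmodType K) c (a : hser B) n : (fpsC c *: a) n = c *: a n.
Proof.
rewrite [LHS](_ : _ = \sum_(i < n.+1) fpsC c i *: a (n - i)%N) //.
rewrite big_ord_recl subn0 big1 ?addr0 // => i _.
by rewrite /fpsC /= scale0r.
Qed.

Lemma hser_trunc (B : lmodType K) (a : hser B) N :
  exists r, a = \sum_(j < N) hpar K ^+ j *: hserC (a j) + hpar K ^+ N *: r.
Proof.
elim: N => [|N [r IH]].
  by exists a; rewrite big_ord0 expr0 scale1r add0r.
have rE : r = hserC (a N) + hpar K *: ((fun n => r n.+1) : hser B).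
  have -> : a N = r 0%N.
    rewrite IH hser_addE hparX_mulE ltnn subnn.
    suff -> : (\sum_(j < N) hpar K ^+ j *: hserC (a j)) N = 0 by rewrite add0r.
    rewrite (_ : _ N = \sum_(j < N) (hpar K ^+ j *: hserC (a j)) N).
      apply: big1 => j _; rewrite hparX_mulE ltnNge ltnW //=.
      by rewrite /hserC subn_eq0 leqNgt ltn_ord.
    by elim/big_rec2: _ => // i y1 y2 _ <-.
  apply/funext => -[|n]; rewrite hser_addE hpar_mulE /hserC /=.
    by rewrite addr0.
  by rewrite add0r.
exists (fun n => r n.+1).
by rewrite {1}IH big_ord_recr /= {1}rE scalerDr addrA exprSr scalerA.
Qed.

Lemma tf_iso_inj V (x y : V) : tf_iso V x = tf_iso V y -> x = y.
Proof. by move=> e; rewrite -(tf_isoK x) e tf_isoK. Qed.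

Section Coef.
Variables (V W : topFree K) (f : {linear V -> W}).

Lemma tf_coef_linear c u v n :
  tf_coef f (c *: u + v) n = c *: tf_coef f u n + tf_coef f v n.
Proof.
have -> : tf_coef f (c *: u + v) = fpsC c *: tf_coef f u + tf_coef f v.
  rewrite /tf_coef -linearP -(linearP f); congr (tf_iso W (f _)).
  apply: tf_iso_inj; rewrite linearP !tf_invK.
  apply/funext => m; rewrite hser_addE fpsC_mulE /hserC.
  by case: eqP; rewrite ?scaler0 ?addr0.
by rewrite hser_addE fpsC_mulE.
Qed.

Lemma tf_coefE v n :
  tf_iso W (f v) n = \sum_(j < n.+1) tf_coef f (tf_iso V v j) (n - j)%N.
Proof.
have [r rE] := hser_trunc (tf_iso V v) n.+1.
have -> : f v = \sum_(j < n.+1) hpar K ^+ j *: f (tf_inv V (hserC (tf_iso V v j)))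
    + hpar K ^+ n.+1 *: f (tf_inv V r).
  rewrite -[v in LHS]tf_isoK {1}rE.
  have -> : tf_inv V (\sum_(j < n.+1) hpar K ^+ j *: hserC (tf_iso V v j)
      + hpar K ^+ n.+1 *: r)
    = \sum_(j < n.+1) hpar K ^+ j *: tf_inv V (hserC (tf_iso V v j))
      + hpar K ^+ n.+1 *: tf_inv V r.
    apply: tf_iso_inj; rewrite tf_invK linearD linear_sum linearZ_LR.
    rewrite tf_invK; congr (_ + _); apply: eq_bigr => j _.
    by rewrite linearZ_LR tf_invK.
  rewrite linearD linear_sum linearZ_LR; congr (_ + _).
  by apply: eq_bigr => j _; rewrite linearZ_LR.
rewrite linearD linear_sum linearZ_LR hser_addE hparX_mulE ltnSn addr0.
rewrite (_ : (\sum_(j < n.+1) _) n = \sum_(j < n.+1)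
   tf_iso W (hpar K ^+ j *: f (tf_inv V (hserC (tf_iso V v j)))) n); last first.
  by elim/big_rec2: _ => // i y1 y2 _ <-.
apply: eq_bigr => j _; rewrite linearZ_LR hparX_mulE ltnNge -ltnS ltn_ord /=.
by [].
Qed.

End Coef.

Lemma ctmap_ctens V1 V2 W1 W2 (f : {linear V1 -> W1}) (g : {linear V2 -> W2})
    (a : V1) (b : V2) :
  ctmap f g (ctens a b) = ctens (f a) (g b).
Proof.
have bil := tens_lift_bilin (tf_coef_linear f) (tf_coef_linear g).
have lin := tens_lift_is_linear bil.
pose T := tens_lift (X := nat -> tensor (tf_base W1) (tf_base W2))
   (fun u w => cauchy (@tens K _ _) (tf_coef f u) (tf_coef g w)).
pose F := GRing.isLinear.Build K _ _ *:%R T lin.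
pose G : {linear tensor (tf_base V1) (tf_base V2) ->
   (nat -> tensor (tf_base W1) (tf_base W2))} := HB.pack T F.
pose H j k p q := tens (tf_coef f (tf_iso V1 a j) p) (tf_coef g (tf_iso V2 b k) q).
apply/funext => n; transitivity (\sum_(i < n.+1) \sum_(j < i.+1)
   \sum_(p < (n - i).+1) H j (i - j)%N p (n - i - p)%N).
  apply: eq_bigr => i _; rewrite -[tens_lift _ _]/(G _) /ctens /cauchy.
  rewrite raddf_sum fct_sumE; apply: eq_bigr => j _ /=.
  by rewrite /T tens_lift_tens.
rewrite (cauchy_sumA (fun j k r => \sum_(p < r.+1) H j k p (r - p)%N)).
under eq_bigr => j _.
  rewrite -(cauchy_sumA (fun k p q => H j k p q)).
  under eq_bigr => i _.
    rewrite (reindex_inj rev_ord_inj) /=.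
    under eq_bigr => k _.
      have kE : (i.+1 - k.+1 = i - k)%N by rewrite subSS.
      have kK : (i - (i - k) = k)%N by rewrite subKn // -ltnS.
      rewrite kE kK; over.
    over.
  rewrite (cauchy_sumA (fun p k q => H j k p q)).
  over.
rewrite -(cauchy_sumA (fun j p r => \sum_(k < r.+1) H j k p (r - k)%N)).
rewrite /ctens /cauchy; apply: eq_bigr => i _.
rewrite tf_coefE (tf_coefE g).
rewrite tens_suml; apply: eq_bigr => j _; by rewrite tens_sumr.
Qed.

End TopFree.

Section Laurent.
Variable K : fieldType.

Definition laurent_pred : {pred int -> K^o} :=
  fun f => `[< exists N : int, forall k : int, k < N -> f k = 0 >].

Lemma laurentP f :
  reflect (exists N : int, forall k : int, k < N -> f k = 0)
    (f \in laurent_pred).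
Proof. exact: asboolP. Qed.

Lemma laurent_closed : submod_closed laurent_pred.
Proof.
split; first by apply/laurentP; exists 0.
move=> c f g /laurentP[N fN] /laurentP[M gM]; apply/laurentP.
exists (Num.min N M) => k; rewrite lt_min => /andP[kN kM].
have -> : (c *: f + g) k = c *: f k + g k by [].
by rewrite fN // gM // scaler0 addr0.
Qed.

HB.instance Definition _ :=
  GRing.isSubmodClosed.Build K (int -> K^o) laurent_pred laurent_closed.

Record laurent := Laurent {
  laurent_val :> int -> K^o;
  laurent_valP : laurent_val \in laurent_pred }.

HB.instance Definition _ := [isSub for laurent_val].
HB.instance Definition _ := [Choice of laurent by <:].
HB.instance Definition _ := [SubChoice_isSubLmodule of laurent by <:].

Lemma laurent1_subproof : (fun k : int => (k == 0)%:R : K^o) \in laurent_pred.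
Proof. by apply/laurentP; exists 0 => k; case: eqP => // ->; rewrite ltxx. Qed.

Definition laurent1 : laurent := Laurent laurent1_subproof.

Definition laurenth : topFree K := hserTF laurent.

End Laurent.

Section Formal.
Variables (K : fieldType) (V : topFree K).

(* A formal distribution sum_k f_k z^k is the function k |-> f_k. *)

Definition in_Vh (f : int -> V) : Prop :=
  forall M : nat, exists N : int, forall k : int, k < N -> eqmodh M (f k) 0.

Definition dz (f : int -> V) : int -> V := fun k => f (k + 1) *~ (k + 1).

End Formal.

Record braided_sfc (K : fieldType) := BraidedSFC {
  sfc_V :> topFree K;
  vac : sfc_V;
  vac_neq0 : vac != 0;
  Tr : {linear sfc_V -> sfc_V};
  Tr_vac : Tr vac = 0;
  Yz : {linear ctensor sfc_V sfc_V -> (int -> sfc_V)};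
  Yz_Vh : forall x, in_Vh (Yz x);
  Yz_vacl : forall (v : sfc_V) (k : int),
    Yz (ctens vac v) k = if k == 0 then v else 0;
  Yz_vacr : forall (v : sfc_V) (k : int), k <= 0 ->
    Yz (ctens v vac) k = if k == 0 then v else 0;
  Yz_dz : forall x,
    dz (Yz x) = (fun k => Tr (Yz x k) - Yz (ctmap idfun Tr x) k);
  Yz_dzl : forall x, dz (Yz x) = Yz (ctmap Tr idfun x);
  Sz : {linear ctensor sfc_V sfc_V ->
          ctensor (ctensor sfc_V sfc_V) (laurenth K)};
  (* S = 1 + O(h), with V^(x)V embedded by x |-> x (x) 1 *)
  Sz_1 : forall x, eqmodh 1 (Sz x)
    (ctens (V2 := laurenth K) x (hserC (laurent1 K))) }.

Section Associativity.
Variables (K : fieldType) (V : braided_sfc K).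
Implicit Types (a b c : V) (F : int -> int -> V).

(* F : int -> int -> V is a two-variable distribution; F i j is the coefficient
   of (first variable)^i (second variable)^j. *)

(* Y(u) (1 (x) Y(w)) (a (x) b (x) c), in the variables (u, w) *)
Definition Y_1Y a b c : int -> int -> V :=
  fun p k => Yz V (ctens a (Yz V (ctens b c) k)) p.

(* Y(w) (Y(z) (x) 1) (a (x) b (x) c), in the variables (z, w) *)
Definition Y_Y1 a b c : int -> int -> V :=
  fun i j => Yz V (ctens (Yz V (ctens a b) i) c) j.

Definition mul_fst_exp (N : nat) F : int -> int -> V :=
  fun p k => F (p - N%:Z) k.

Definition mul_zw F : int -> int -> V :=
  fun i j => F (i - 1) j + F i (j - 1).

Definition binz (x : int) (l : nat) : K :=
  (\prod_(k < l) (x%:~R - k%:R)) / l`!%:R.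

(* The coefficient of z^i w^j in iota_{z,w} F(z + w, w) is
   sum_(l >= 0) binz (i + l) l F_(i + l, j - l), because
   iota_{z,w} (z + w)^p = sum_(l >= 0) binz p l z^(p - l) w^l; this is its
   l-th summand. *)
Definition iota_term F (i j : int) (l : nat) : V :=
  fpsC (binz (i + l%:Z) l) *: F (i + l%:Z) (j - l%:Z).

(* sum_(l >= 0) f l = s modulo h^M: the partial sums are eventually s
   modulo h^M. For iota_term the sum is finite modulo h^M, since
   Y(b, w) c lies in V_h((w)). *)
Definition hsum_mod (M : nat) (f : nat -> V) (s : V) : Prop :=
  exists L0 : nat, forall L : nat, (L0 <= L)%N -> eqmodh M (\sum_(l < L) f l) s.

(* iota_{z,w} (z+w)^N Y(z+w)(1 (x) Y(w))(a (x) b (x) c)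
     = (z+w)^N Y(w)(Y(z) (x) 1)(a (x) b (x) c)  mod h^M *)
Definition assoc_at a b c (M N : nat) : Prop :=
  forall i j : int,
    hsum_mod M (iota_term (mul_fst_exp N (Y_1Y a b c)) i j)
      (iter N mul_zw (Y_Y1 a b c) i j).

Definition associative_sfc : Prop :=
  forall a b c (M : nat), exists N : nat, assoc_at a b c M N.

End Associativity.

Section Lambda.
Variables (K : fieldType) (V : braided_sfc K).
Implicit Types (a b c : V) (P Q : nat -> nat -> V).

(* a_(n) b is the coefficient of z^(-n-1). *)
Definition nprod (n : int) a b : V := Yz V (ctens a b) (- n - 1).

(* The coefficient of lambda^n in a_lambda b, in V[[lambda]]. *)
Definition lamprod a b (n : nat) : V := fpsC (n`!%:R^-1) *: nprod n%:Z a b.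

(* P p q is the coefficient of lambda^p mu^q. *)

Definition lam_l a b c : nat -> nat -> V := fun p q => lamprod a (lamprod b c q) p.

(* (a_lambda b)_(lambda + mu) c: the monomial lambda^p mu^q occurs in
   lambda^m (lambda + mu)^n, with coefficient 'C(n, q), iff m <= p and
   n = p - m + q. *)
Definition lam_r a b c : nat -> nat -> V := fun p q =>
  \sum_(m < p.+1)
    lamprod (lamprod a b m) c (p - m + q)%N *+ 'C(p - m + q, q).

Definition dlam P : nat -> nat -> V := fun p q => P p.+1 q *+ p.+1.

Definition eqmodh2 (M : nat) P Q : Prop := forall p q, eqmodh M (P p q) (Q p q).

End Lambda.

(* Main.v *)
(** Let A be the distribution Y(u)(1 (x) Y(w))(a (x) b (x) c) and B the
distribution Y(w)(Y(z) (x) 1)(a (x) b (x) c). Applying Res_z (z+w)^p to the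
associativity relation turns its right-hand side into Res_z (z+w)^(p+N) B,
which carries the coefficients of (a_lambda b)_(lambda+mu) c. On the left-hand
side the expansion of (z+w)^(-r-1+l) contributes to z^(-r-1) w^l the
coefficient (-1)^l C(r, l), which vanishes for l > r; so the sum is finite and
binomial inversion leaves Res_u u^(p+N) A, which carries the coefficients of
a_lambda (b_mu c). *)
From HB Require Import structures.
Require Import Defs.
From mathcomp Require Import all_boot all_order all_algebra.
From mathcomp Require Import boolp zify ring.

Set Implicit Arguments.
Unset Strict Implicit.
Unset Printing Implicit Defensive.

Import GRing.Theory.
Local Open Scope ring_scope.

Lemma sum_binS (M : nmodType) (y : nat -> M) p :
  \sum_(r < p.+2) y r *+ 'C(p.+1, r) =
  \sum_(r < p.+1) y r *+ 'C(p, r) + \sum_(r < p.+1) y r.+1 *+ 'C(p, r).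
Proof.
rewrite big_ord_recl bin0.
under eq_bigr => r _ do rewrite binS mulrnDr.
rewrite big_split /= addrA; congr (_ + _).
rewrite big_ord_recr /= bin_small // mulr0n addr0.
by rewrite [RHS]big_ord_recl bin0.
Qed.

(** Newton's forward difference formula: the inner sum is the [r]-th difference of [x] at 0, and the
    shift operator is 1 plus the difference operator. *)
Lemma binomial_inversion (R : pzRingType) (M : lmodType R) (x : nat -> M) p :
  \sum_(r < p.+1)
    (\sum_(l < r.+1) ((-1) ^+ l *: x (r - l)%N) *+ 'C(r, l)) *+ 'C(p, r) = x p.
Proof.
pose D x r := \sum_(l < r.+1) ((-1) ^+ l *: x (r - l)%N : M) *+ 'C(r, l).
have DS y r : D y r.+1 = D (y \o succn) r - D y r.
  rewrite {1}/D (sum_binS (fun l => (-1) ^+ l *: y (r.+1 - l)%N)).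
  congr (_ + _).
    by apply: eq_bigr => l _; rewrite /= subSn // -ltnS.
  rewrite -sumrN; apply: eq_bigr => l _.
  by rewrite subSS exprS mulN1r scaleNr mulNrn.
rewrite -[LHS]/(\sum_(r < p.+1) D x r *+ 'C(p, r)).
elim: p x => [|p IH] x.
  by rewrite /D !big_ord1 /= scale1r.
rewrite sum_binS -big_split /= -[RHS](IH (x \o succn)).
by apply: eq_bigr => r _; rewrite -mulrnDl DS addrC subrK.
Qed.

Section FpsC.
Variable K : fieldType.

(** [fpsC] is made a ring morphism so that identities between constant scalars of K[[h]] reduce to
    identities in K. *)
Lemma fpsC_is_zmod_morphism : zmod_morphism (@fpsC K).
Proof.
move=> c d; apply/funext => n; rewrite [RHS]/(fpsC c n - fpsC d n) /fpsC.
by case: eqP => // _; apply: esym (subr0 0).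
Qed.

HB.instance Definition _ :=
  GRing.isZmodMorphism.Build K (fps K) (@fpsC K) fpsC_is_zmod_morphism.

Lemma fpsC_is_monoid_morphism : monoid_morphism (@fpsC K).
Proof.
split=> // c d; apply/funext => n.
rewrite [RHS](_ : _ = \sum_(i < n.+1) fpsC c i * fpsC d (n - i)%N) //.
rewrite big_ord_recl subn0 big1 ?addr0 => [|i _]; last by rewrite mul0r.
by rewrite /fpsC /=; case: eqP; rewrite ?mulr0.
Qed.

HB.instance Definition _ :=
  GRing.isMonoidMorphism.Build K (fps K) (@fpsC K) fpsC_is_monoid_morphism.

End FpsC.

Section CompletedTensor.
Variables (K : fieldType) (V W : topFree K).

Lemma ctensZl (k : K) (a : V) (b : W) :
  ctens (fpsC k *: a) b = fpsC k *: ctens a b.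
Proof.
apply/funext => n; rewrite fpsC_mulE /ctens /cauchy scaler_sumr linearZ_LR.
by apply: eq_bigr => i _; rewrite fpsC_mulE tensZl.
Qed.

Lemma ctensZr (k : K) (a : V) (b : W) :
  ctens a (fpsC k *: b) = fpsC k *: ctens a b.
Proof.
apply/funext => n; rewrite fpsC_mulE /ctens /cauchy scaler_sumr linearZ_LR.
by apply: eq_bigr => i _; rewrite fpsC_mulE tensZr.
Qed.

End CompletedTensor.

Section Eqmodh.
Variables (K : fieldType) (V : topFree K) (M : nat).
Implicit Types x y : V.

Lemma eqmodhxx x : eqmodh M x x.
Proof. by exists 0; rewrite subrr scaler0. Qed.

Lemma eqmodhD x y x' y' :
  eqmodh M x y -> eqmodh M x' y' -> eqmodh M (x + x') (y + y').
Proof.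
by case=> v e [v' e']; exists (v + v'); rewrite scalerDr -e -e' opprD addrACA.
Qed.

Lemma eqmodhZ f x y : eqmodh M x y -> eqmodh M (f *: x) (f *: y).
Proof.
by case=> v e; exists (f *: v); rewrite -scalerBr e !scalerA mulrC.
Qed.

Lemma eqmodhMn n x y : eqmodh M x y -> eqmodh M (x *+ n) (y *+ n).
Proof. by rewrite -!(scaler_nat n); apply: eqmodhZ. Qed.

Lemma eqmodh_sum (I : finType) (F G : I -> V) :
  (forall i, eqmodh M (F i) (G i)) ->
  eqmodh M (\sum_i F i) (\sum_i G i).
Proof.
move=> FG; elim/big_rec2: _ => [|i y x _]; first exact: eqmodhxx.
exact: eqmodhD.
Qed.

End Eqmodh.

Lemma natr_fact_neq0 (K : fieldType) n :
  [pchar K] =i pred0 -> n`!%:R != 0 :> K.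
Proof. by move/pcharf0P => ->; rewrite -lt0n fact_gt0. Qed.

Lemma prod_natrB (R : pzRingType) r l :
  \prod_(k < l) (r%:R - k%:R) = (r ^_ l)%:R :> R.
Proof.
elim: l => [|l IH]; first by rewrite big_ord0.
rewrite big_ord_recr /= IH ffactnSr natrM.
have [lr|rl] := leqP l r; first by rewrite natrB.
by rewrite ffact_small // !mul0r.
Qed.

(** Replacing [k] by [l - 1 - k] turns each factor into [-(r - k)], so the product is a signed
    falling factorial of [r]; characteristic zero makes [l!] invertible. *)
Lemma binz_negS (K : fieldType) (r l : nat) : [pchar K] =i pred0 ->
  binz K (- r%:Z - 1 + l%:Z) l = (-1) ^+ l *+ 'C(r, l).
Proof.
move=> charK; rewrite /binz (reindex_inj rev_ord_inj) /=.
rewrite (eq_bigr (fun k : 'I_l => - (r%:R - k%:R))) => [|k _]; last first.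
  by rewrite natrB // !rmorphD !rmorphN /= -!pmulrn; ring.
rewrite prodrN card_ord prod_natrB -bin_ffact natrM mulrA.
by rewrite mulfK ?natr_fact_neq0 // mulr_natr.
Qed.

Section BraidedLambda.
Variables (K : fieldType) (charK : [pchar K] =i pred0) (V : braided_sfc K).
Implicit Types (a b c : V) (F G : int -> int -> V).

(* The coefficient of w^(-q-1) in Res_z (z + w)^p F(z, w). *)
Definition res_zw (p q : nat) F : V :=
  \sum_(m < p.+1)
    F (- m%:Z - 1) (- (p - m + q)%N%:Z - 1) *+ 'C(p, m).

(** By Pascal's rule, the extra factor z + w is absorbed into the power (z + w)^p under the
    residue. *)
Lemma res_zw_mul p q F : res_zw p q (mul_zw F) = res_zw p.+1 q F.
Proof.
rewrite /res_zw.
rewrite (sum_binS (fun m => F (- m%:Z - 1) (- (p.+1 - m + q)%N%:Z - 1))).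
rewrite -big_split; apply: eq_bigr => m _ /=; have := ltn_ord m => mp.
rewrite /mul_zw -mulrnDl addrC; congr ((F _ _ + F _ _) *+ _); lia.
Qed.

Lemma res_zw_iter N p q F :
  res_zw p q (iter N (@mul_zw K V) F) = res_zw (p + N) q F.
Proof.
by elim: N p => [|N IH] p; rewrite ?addn0 // iterS res_zw_mul IH addSnnS.
Qed.

Lemma iota_term_negS G (r l : nat) (j : int) :
  iota_term G (- r%:Z - 1) j l =
  ((-1) ^+ l *: G (- r%:Z - 1 + l%:Z) (j - l%:Z)) *+ 'C(r, l).
Proof.
rewrite /iota_term binz_negS // rmorphMn rmorphXn rmorphN1.
by rewrite -mulr_natl -scalerA scaler_nat.
Qed.

Lemma hsum_iota_negS M G (r : nat) (j : int) s :
  hsum_mod M (iota_term G (- r%:Z - 1) j) s ->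
  eqmodh M (\sum_(l < r.+1)
    ((-1) ^+ l *: G (- r%:Z - 1 + l%:Z) (j - l%:Z)) *+ 'C(r, l)) s.
Proof.
(* This truncation passes both [L0], after which partial sums are settled modulo h^M, and [r], after
   which all terms vanish. *)
case=> L0 /(_ (r.+1 + L0)%N (leq_addl _ _)).
rewrite big_split_ord /= [X in _ + X]big1 ?addr0 => [|l _]; last first.
  by rewrite iota_term_negS bin_small // leq_addr.
by under eq_bigr do rewrite iota_term_negS.
Qed.

(** Substitution u = z + w under the residue: Res_u u^p G(u, w) agrees with Res_z (z + w)^p F(z,
    w). *)
Lemma res_zw_iota M G F :
  (forall i j, hsum_mod M (iota_term G i j) (F i j)) ->
  forall p q : nat, eqmodh M (G (- p%:Z - 1) (- q%:Z - 1)) (res_zw p q F).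
Proof.
move=> GF p q.
(* All coefficients of [G] involved have total degree -p - q - 2, so they form one sequence, and the
   residue is the Newton expansion of its [p]-th term. *)
pose x s := G (- s%:Z - 1) (- (p%:Z - s%:Z + q%:Z) - 1).
have -> : G (- p%:Z - 1) (- q%:Z - 1) = x p.
  by rewrite /x subrr add0r.
rewrite -(binomial_inversion x); apply: eqmodh_sum => r; apply: eqmodhMn.
have rp := ltn_ord r.
under eq_bigr => l _.
  have lr := ltn_ord l.
  have -> : x (r - l)%N = G (- r%:Z - 1 + l%:Z)
      (- (p - r + q)%N%:Z - 1 - l%:Z).
    by rewrite /x; congr (G _ _); lia.
  over.
exact: hsum_iota_negS.
Qed.

(** On the left, the factor u^N only shifts exponents, which turns [p] into [p + N]. *)
Lemma assoc_res M N a b c : assoc_at a b c M N ->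
  forall p q : nat,
  eqmodh M (Y_1Y a b c (- (p + N)%N%:Z - 1) (- q%:Z - 1))
           (res_zw (p + N) q (Y_Y1 a b c)).
Proof.
move=> /res_zw_iota ass p q; have := ass p q; rewrite res_zw_iter.
by rewrite /mul_fst_exp (_ : _ - 1 - N%:Z = - (p + N)%N%:Z - 1) //; lia.
Qed.

Lemma lam_lE a b c (p q : nat) :
  lam_l a b c p q =
  fpsC (p`!%:R^-1 * q`!%:R^-1) *: Y_1Y a b c (- p%:Z - 1) (- q%:Z - 1).
Proof.
by rewrite /lam_l /lamprod /nprod ctensZr linearZ_LR rmorphM -scalerA.
Qed.

Lemma lam_rE a b c (p q : nat) :
  lam_r a b c p q =
  fpsC (p`!%:R^-1 * q`!%:R^-1) *: res_zw p q (Y_Y1 a b c).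
Proof.
rewrite /lam_r /res_zw scaler_sumr; apply: eq_bigr => m _.
have mp : (m <= p)%N by rewrite -ltnS.
rewrite /lamprod /nprod ctensZl linearZ_LR /=.
rewrite -!scaler_nat !scalerA -(rmorph_nat (@fpsC K)).
rewrite -(rmorph_nat (@fpsC K) 'C(p, m)) -!rmorphM; congr (fpsC _ *: _).
(* In factorials, both scalars become 1 / (m! q! (p - m)!). *)
have facE n k : (k <= n)%N ->
    'C(n, k)%:R = n`!%:R / (k`!%:R * (n - k)`!%:R) :> K.
  move=> kn; rewrite -(bin_fact kn) !natrM mulfK //.
  by rewrite mulf_neq0 ?natr_fact_neq0.
rewrite !facE ?leq_addl // addnK.
by field; rewrite ?natr_fact_neq0.
Qed.

(** N derivatives discard the powers of lambda below N and multiply the other coefficients by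
    integers. *)
Lemma eqmodh2_iter_dlam M N (P Q : nat -> nat -> V) :
  (forall p q, eqmodh M (P (p + N)%N q) (Q (p + N)%N q)) ->
  eqmodh2 M (iter N (@dlam K V) P) (iter N (@dlam K V) Q).
Proof.
elim: N P Q => [|N IH] P Q PQ.
  by move=> p q; have := PQ p q; rewrite addn0.
rewrite !iterSr; apply: IH => p q; apply: eqmodhMn.
by rewrite -addnS; apply: PQ.
Qed.

End BraidedLambda.

Theorem proposition6 (K : fieldType) (charK : [pchar K]%R =i pred0)
    (V : braided_sfc K) (assocV : associative_sfc V)
    (a b c : V) (M N : nat) (assocN : assoc_at a b c M N) :
  eqmodh2 M (iter N (@dlam K V) (lam_l a b c))
            (iter N (@dlam K V) (lam_r a b c)).
Proof.
apply: eqmodh2_iter_dlam => p q; rewrite lam_lE lam_rE //.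
exact/eqmodhZ/assoc_res.
Qed.
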